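(* There exist absolute constants $C>0$ and $K>0$ such that the following holds for every integer $n \ge 1$ and every real $m$ with $0 \le m \le 0.001\,n$. Let $x_1,\dots,x_n$ be independent random variables, each uniformly distributed on $[0,1]$, and let $X=\{x_1,\dots,x_n\}$. Then, with probability at least $1-K n^{-C}$, there exists a subset $Y\subset X$ with $$\# Y \ge \# X - m$$ such that $$\max_{0\le x\le 1}\left|\frac{\#(Y\cap[0,x])}{\# Y}-x\right|\le 100\,\frac{\log n}{m}$$ (for $m=0$ the right-hand side is interpreted as $+\infty$). In particular, if $m=cn$ for some $c\in(0,0.001]$, this bound reads $$\max_{0\le x\le 1}\left|\frac{\#(Y\cap[0,x])}{\# Y}-x\right|\le \frac{100}{c}\,\frac{\log n}{n},$$ and for $n\ge 2$ the right-hand side satisfies $\frac{100}{c}\frac{\log n}{n}\sim\frac{\log \# Y}{\# Y}$, i.e. the two quantities are comparable up to positive multiplicative constants depending only on $c$.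
   Context: $\#$ denotes cardinality and $\log$ is the natural logarithm. The points $x_1,\dots,x_n$ are almost surely distinct, so $\#X=n$ almost surely. The subset $Y$ may depend on the realization of $X$. Convention: an event depending on $n$ holds ''with high likelihood'' (or ''with high probability'') if the probability of its complement is of the order $n^{-C}$ for some constant $C>0$; this is what is written out explicitly in the claim. *)

(* Defs.v *)
From HB Require Import structures.
From mathcomp Require Export all_boot all_order all_algebra finmap.
From mathcomp Require Export all_classical all_reals all_analysis.
Export Order.TTheory GRing.Theory Num.Theory.
Export numFieldNormedType.Exports.

Set Implicit Arguments.
Unset Strict Implicit.
Unset Printing Implicit Defensive.

Local Open Scope classical_set_scope.
Local Open Scope ring_scope.

Definition mutually_independent (R : realType) (d : measure_display)
    (T : measurableType d) (P : probability T R) (n : nat)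
    (x : 'I_n -> {RV P >-> R}) : Prop :=
  forall (J : {set 'I_n}) (B : 'I_n -> set R),
    (forall i, measurable (B i)) ->
    P (\bigcap_(i in [set` J]) (x i @^-1` B i)) =
      (\prod_(i in J) P (x i @^-1` B i))%E.

Definition uniform01 (R : realType) (d : measure_display)
    (T : measurableType d) (P : probability T R) (X : {RV P >-> R}) : Prop :=
  forall A : set R, measurable A ->
    distribution P X A = uniform_prob (@ltr01 R) A.

Definition iid_uniform01 (R : realType) (d : measure_display)
    (T : measurableType d) (P : probability T R) (n : nat)
    (x : 'I_n -> {RV P >-> R}) : Prop :=
  mutually_independent x /\ forall i, uniform01 (x i).

(* A set of values: coinciding points are counted once. *)
Definition sample (R : realType) (d : measure_display)
    (T : measurableType d) (P : probability T R) (n : nat)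
    (x : 'I_n -> {RV P >-> R}) (w : T) : {fset R} :=
  [fset x i w | i : 'I_n]%fset.

Definition ncard (R : realType) (Y : {fset R}) : R := (#|` Y|)%:R.

(* The supremum need not be attained (the counting function is only
   right-continuous), hence sup rather than a maximum. *)
Definition discrepancy (R : realType) (Y : {fset R}) : R :=
  sup [set `| ncard [fset y in Y | (0 <= y <= t)%R]%fset / ncard Y - t |
      | t in `[0, 1] ].

(* The case split is needed because division by zero gives zero. *)
Definition discrepancy_bound (R : realType) (n : nat) (m : R) : \bar R :=
  if m == 0 then +oo%E else (100 * (ln n%:R / m))%:E.

(* The points are almost surely distinct, so for m < n an admissible Y is
   almost surely nonempty and its discrepancy involves no division by zero. *)
Definition good_subset_event (R : realType) (d : measure_display)
    (T : measurableType d) (P : probability T R) (n : nat)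
    (x : 'I_n -> {RV P >-> R}) (m : R) (b : \bar R) : set T :=
  [set w | exists Y : {fset R},
    [/\ (Y `<=` sample x w)%fset,
        ncard (sample x w) - m <= ncard Y &
        ((discrepancy Y)%:E <= b)%E]].

Definition holds_with_prob_ge (R : realType) (d : measure_display)
    (T : measurableType d) (P : probability T R) (p : R) (E : set T) : Prop :=
  measurable E /\ (p%:E <= P E)%E.

(* Main.v *)
Require Import Defs.
From mathcomp Require Import measurable_realfun ring lra zify.

Set Implicit Arguments.
Unset Strict Implicit.
Unset Printing Implicit Defensive.

Local Open Scope classical_set_scope.
Local Open Scope ring_scope.

(** Deleting points is only needed to remove local excesses, so a lower bound
    on the number of points in every interval is enough.

    Suppose every interval ]a, b] contains at least r (b - a) - tau points of
    X.  Read X from left to right and keep a point only if the number of kept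
    points stays below r times its position ([greedy_subset]).  The counting
    function of the kept set Y never exceeds r t.  Since the last rejection,
    at a position s where it exceeds r s - 1, every point has been kept, so
    it is at least r t - tau - 1.  Hence Y is within tau + 1 of
    equidistribution, and it has at least r - tau - 1 elements
    ([lower_spread_subset]).

    For n independent uniform points, a Chernoff bound with parameter la gives
    r = (1 - la) n and tau = 3 (ln n) / la with failure probability n^-3 for
    a single interval ([lower_tail], [prob_sparse]).  The (n + 1)^2 pairs of
    endpoints in the grid of mesh 1/n suffice ([lower_spread_grid]), whence a
    total failure probability of at most 4 / n.

    If m^2 is large compared with n ln n, take la = m / (2 n): then
    tau = 6 n (ln n) / m, about m / 2 + tau <= m points are deleted, and the
    discrepancy is about tau / n = 6 (ln n) / m.  Otherwise so many deletions
    are not available, but none is needed: with la = 8 (ln n) / m the lower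
    bounds on ]0, t] and on ]t, 1] bound the counting function of X from both
    sides by n t up to la n + tau, which is at most a constant times
    n (ln n) / m because m^2 is at most a constant times n ln n
    ([lower_spread_two_sided]).  Both cases are in
    [well_spread_subset_exists].

    The event is measurable because a subset of the sample is selected by one
    of finitely many sets of indices, and because the deviations at rational
    abscissas determine the discrepancy. *)

(** * Greedy selection from the left *)

Section Counting.
Context {R : realType}.
Implicit Types (X Y : {fset R}) (p q : pred R).

Definition count_in Y p : R := ncard [fset y in Y | p y]%fset.

Lemma count_inE Y p : count_in Y p = \sum_(y <- Y) (p y)%:R.
Proof.
rewrite /count_in /ncard card_fset_sum1 -(big_fset_condE _ Y p (fun=> 1%N)).
by rewrite natr_sum [LHS]big_mkcond; apply: eq_bigr => y _; case: (p y).
Qed.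

Lemma count_in_ge0 Y p : 0 <= count_in Y p.
Proof. exact: ler0n. Qed.

Lemma ncardE Y : ncard Y = count_in Y predT.
Proof.
by rewrite count_inE /ncard card_fset_sum1 natr_sum; apply: eq_bigr => y _.
Qed.

Lemma eq_count_in Y p q : {in Y, p =1 q} -> count_in Y p = count_in Y q.
Proof.
by move=> pq; rewrite !count_inE big_seq [RHS]big_seq; apply: eq_bigr => y /pq ->.
Qed.

Lemma le_count_in Y p q : {in Y, forall y, p y -> q y} -> count_in Y p <= count_in Y q.
Proof.
move=> pq; rewrite !count_inE big_seq [leRHS]big_seq; apply: ler_sum => y /pq.
by case: (p y) => [->|_] //; rewrite ler_nat.
Qed.

Lemma count_inU1 Y z p : z \notin Y -> count_in (z |` Y)%fset p = (p z)%:R + count_in Y p.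
Proof. by move=> zY; rewrite !count_inE big_fsetU1. Qed.

Lemma count_in_split Y p q1 q2 : {in Y, forall y, p y = (q1 y (+) q2 y) :> bool} ->
  {in Y, forall y, ~~ (q1 y && q2 y)} -> count_in Y p = count_in Y q1 + count_in Y q2.
Proof.
move=> H K; rewrite !count_inE -big_split/= big_seq [RHS]big_seq.
apply: eq_bigr => y yY; rewrite H//; have := K y yY.
by case: (q1 y); case: (q2 y) => //=; rewrite ?addr0 ?add0r.
Qed.

Lemma fset_max Y : Y != fset0 -> exists2 z, z \in Y & {in Y, forall y, y <= z}.
Proof.
have: exists s : seq R, s =i Y by exists Y.
case=> s; elim: s Y => [|a s IH] Y sY.
  by move=> /fset0Pn[y]; rewrite -sY.
move=> _; have [s0|] := eqVneq [fset y in s]%fset fset0.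
  exists a; first by rewrite -sY mem_head.
  move=> y; rewrite -sY inE => /predU1P[->//|ys].
  by move/fsetP: s0 => /(_ y); rewrite !inE ys.
move=> /(IH _)[|z]; first by move=> y; rewrite !inE.
rewrite !inE => zs zmax; have [az|za] := leP a z.
  exists z; first by rewrite -sY inE zs orbT.
  move=> y; rewrite -sY inE => /predU1P[->//|ys].
  by apply: zmax; rewrite !inE.
exists a; first by rewrite -sY mem_head.
move=> y; rewrite -sY inE => /predU1P[->//|ys].
by apply: le_trans (ltW za); apply: zmax; rewrite !inE.
Qed.

(** The witness s is the position of the last rejection before t, or 0 if
    there is none: a rejection at s means that the count exceeded r s - 1, and
    every point of X in ]s, t] has been kept.  The induction removes the
    largest point of X, which does not affect the counts to its left. *)
Lemma greedy_subset X (r : R) : 0 <= r -> {in X, forall x : R, 0 < x} ->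
  exists2 Y : {fset R}, (Y `<=` X)%fset &
    forall t : R, 0 <= t -> count_in Y (fun y : R => 0 <= y <= t) <= r * t /\
      exists2 s : R, 0 <= s <= t &
        r * s - 1 + count_in X (fun x : R => s < x <= t)
          <= count_in Y (fun y : R => 0 <= y <= t).
Proof.
move=> r0; move Ek : #|` X| => k; elim: k X Ek => [|k IH] X Xk X0.
  exists fset0; first exact: fsub0set.
  move=> t t0; have -> : X = fset0 by apply: cardfs0_eq.
  rewrite !count_inE !big_seq_fset0; split; first exact: mulr_ge0.
  by exists 0; rewrite ?lexx// count_inE big_seq_fset0; lra.
have Xn0 : X != fset0 by rewrite -cardfs_gt0 Xk.
have [z zX zmax] := fset_max Xn0.
pose X' := (X `\ z)%fset.
have zX' : z \notin X' by rewrite !inE eqxx.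
have X'X : (X' `<=` X)%fset by exact: fsubD1set.
have XE : X = (z |` X')%fset by rewrite fsetD1K.
have X'k : #|` X'| = k by have := cardfsD1 z X; rewrite zX Xk => -[].
have X'0 : {in X', forall x, 0 < x} by move=> x /(fsubsetP X'X) /X0.
have [Y' Y'X' HY'] := IH _ X'k X'0.
have zY' : z \notin Y' by apply: contra zX' => /(fsubsetP Y'X').
have Y'X : (Y' `<=` X)%fset := fsubset_trans Y'X' X'X.
have z0 : 0 < z by exact: X0.
have Y'full (t : R) : z <= t -> count_in Y' (fun y : R => 0 <= y <= t) = ncard Y'.
  move=> zt; rewrite ncardE; apply: eq_count_in => y /(fsubsetP Y'X) yX /=.
  by rewrite (ltW (X0 _ yX)) (le_trans (zmax _ yX) zt).
(* Keep z exactly when the upper bound at t = z allows one more point. *)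
have [acc|rej] := leP (ncard Y' + 1) (r * z).
  exists (z |` Y')%fset; first by rewrite XE; apply: fsetUS.
  move=> t t0; have [up [s st lo]] := HY' t t0.
  rewrite XE !count_inU1// (ltW z0)/=; have [zt|tz] := leP z t.
    split.
      by rewrite Y'full//= addrC; apply: le_trans acc _; apply: ler_wpM2l.
    exists s => //; rewrite count_inU1//=.
    by case: (s < z) => /=; move: lo; rewrite ?zt/=; lra.
  by rewrite add0r; split => //; exists s; rewrite ?count_inU1//= ?(leNgt z) ?tz ?andbF ?add0r.
exists Y' => // t t0; have [up [s st lo]] := HY' t t0; split => //.
have [zt|tz] := leP z t.
  exists z; first by rewrite zt ltW.
  have -> : count_in X (fun x : R => z < x <= t) = 0.
    rewrite count_inE big_seq big1// => x /zmax xz.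
    by rewrite ltNge xz.
  by rewrite Y'full//; lra.
by exists s => //; rewrite XE count_inU1//= (leNgt z) tz andbF add0r.
Qed.

End Counting.

(** * Discrepancy from lower bounds on interval counts *)

Section LowerSpread.
Context {R : realType}.
Implicit Types (X Y : {fset R}).

Definition gap Y (t : R) : R :=
  `|count_in Y (fun y : R => 0 <= y <= t) / ncard Y - t|.

Lemma discrepancy_le Y (b : R) :
  (forall t : R, 0 <= t <= 1 -> gap Y t <= b) -> discrepancy Y <= b.
Proof.
move=> H; apply: ge_sup.
  by exists (gap Y 0), 0 => //=;
    rewrite in_itv/= lexx ler01.
by move=> _ [t /= + <-]; rewrite in_itv/= => /H.
Qed.

Lemma discrepancy_le_div Y (D : R) : 0 < ncard Y ->
  (forall t : R, 0 <= t <= 1 ->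
    `|count_in Y (fun y : R => 0 <= y <= t) - ncard Y * t| <= D) ->
  discrepancy Y <= D / ncard Y.
Proof.
move=> Y0 H; apply: discrepancy_le => t /H {}H; rewrite /gap.
rewrite ler_pdivlMr// -[X in _ * X](gtr0_norm Y0) -normrM mulrBl.
by rewrite mulfVK ?gt_eqF// [t * _]mulrC.
Qed.

(** There is no matching upper bound: excesses are what the
    deletion of points repairs. *)
Definition lower_spread X (r tau : R) := forall a b : R, 0 <= a -> a <= b ->
  b <= 1 -> r * (b - a) - tau <= count_in X (fun x : R => a < x <= b).

(** The greedy subset has its counting function between r t - tau - 1 and r t;
    its own cardinality is the value at 1, so it satisfies the same bounds
    with t = 1. *)
Lemma lower_spread_subset X (r tau : R) : 0 <= r -> {in X, forall x : R, 0 < x} ->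
  {in X, forall x : R, x <= 1} -> lower_spread X r tau ->
  exists2 Y : {fset R}, (Y `<=` X)%fset & r - tau - 1 <= ncard Y /\
    (0 < ncard Y -> discrepancy Y <= (tau + 1) / ncard Y).
Proof.
move=> r0 X0 X1 HX; have [Y YX HY] := greedy_subset r0 X0.
have both (t : R) : 0 <= t <= 1 ->
    r * t - tau - 1 <= count_in Y (fun y : R => 0 <= y <= t) <= r * t.
  move=> /andP[t0 t1]; have [up [s /andP[s0 st] lo]] := HY t t0.
  by rewrite up andbT; have := HX s t s0 st t1; lra.
have Y1 : ncard Y = count_in Y (fun y : R => 0 <= y <= 1).
  rewrite ncardE; apply: eq_count_in => y /(fsubsetP YX) yX.
  by rewrite (ltW (X0 _ yX)) X1.
have := both 1; rewrite ler01 lexx -Y1 mulr1 => /(_ isT)/andP[lo1 up1].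
exists Y => //; split => // Y0; apply: discrepancy_le_div => // t t01.
have /andP[lo up] := both t t01; move: t01 => /andP[t0 t1].
have Nt := ler_wpM2r t0 lo1; have Nt' := ler_wpM2r t0 up1.
have tau1 : 0 <= (tau + 1) * (1 - t) by apply: mulr_ge0; lra.
rewrite ler_norml; lra.
Qed.

(** An upper bound on the count in [0, t] is a lower bound on the count in
    ]t, 1], so the one-sided hypothesis controls X itself from both sides. *)
Lemma lower_spread_two_sided X (n la tau : R) : 0 <= la -> 0 <= n ->
  {in X, forall x : R, 0 < x} -> {in X, forall x : R, x <= 1} ->
  ncard X = n -> lower_spread X ((1 - la) * n) tau ->
  forall t : R, 0 <= t <= 1 ->
    `|count_in X (fun y : R => 0 <= y <= t) - ncard X * t| <= la * n + tau.
Proof.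
move=> la0 n0 X0 X1 Xn HX t /andP[t0 t1].
have lo := HX 0 t (lexx _) t0 t1; have hi := HX t 1 t0 t1 (lexx _).
have E1 : count_in X (fun y : R => 0 <= y <= t) = count_in X (fun y : R => 0 < y <= t).
  by apply: eq_count_in => y /X0 y0; rewrite y0 ltW.
have E2 : ncard X = count_in X (fun y : R => 0 < y <= t) +
    count_in X (fun y : R => t < y <= 1).
  rewrite ncardE; apply: count_in_split => y yX; rewrite X0// X1//= andbT; first by case: leP.
  by rewrite leNgt andNb.
have lan : 0 <= la * n * (1 - t) by rewrite mulr_ge0 ?mulr_ge0 ?subr_ge0.
have lan' : 0 <= la * n * t by rewrite mulr_ge0 ?mulr_ge0.
rewrite E1 ler_norml; move: E2; rewrite Xn; lra.
Qed.

(** Rounding a and b inwards to the grid shortens ]a, b] by less than 2 / n,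
    which costs at most 2 points. *)
Lemma lower_spread_grid X (n : nat) (la tau : R) : (0 < n)%N ->
  0 <= la -> 0 <= tau ->
  (forall i j : 'I_n.+1, (i <= j)%N -> (1 - la) * (j%:R - i%:R) - tau
     <= count_in X (fun x : R => i%:R / n%:R < x <= j%:R / n%:R)) ->
  lower_spread X ((1 - la) * n%:R) (tau + 2).
Proof.
move=> n0 la0 tau0 H a b a0 ab b1.
have n0R : 0 < n%:R :> R by rewrite ltr0n.
have [la1|la1] := leP 1 la.
  apply: le_trans (count_in_ge0 _ _).
  have : 0 <= (la - 1) * n%:R * (b - a).
    by apply: mulr_ge0; [apply: mulr_ge0|]; rewrite ?subr_ge0// ltW.
  lra.
pose j := Num.truncn (b * n%:R).
have b0 : 0 <= b by lra.
have jb : j%:R <= b * n%:R < j.+1%:R.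
  by apply: truncn_itv; apply: mulr_ge0 => //; exact: ltW.
pose i := (Num.truncn (a * n%:R)).+1.
have ia : i.-1%:R <= a * n%:R < i%:R.
  by apply: truncn_itv; apply: mulr_ge0 => //; exact: ltW.
have bn : b * n%:R <= n%:R by rewrite ger_pMl.
have jn : (j < n.+1)%N.
  by rewrite ltnS -(ler_nat R); case/andP: jb => jb _; lra.
have [iN|Ni] := ltnP i n.+1; last first.
  apply: le_trans (count_in_ge0 _ _).
  have : n.+1%:R <= i%:R :> R by rewrite ler_nat.
  move/andP: ia; rewrite -[i]/(i.-1.+1) -!natr1 => -[ia _] ni.
  have : 0 <= (1 - la) * (1 - (b * n%:R - a * n%:R)) by apply: mulr_ge0; lra.
  lra.
have [ij|ji] := leqP i j; last first.
  apply: le_trans (count_in_ge0 _ _).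
  have : j.+1%:R <= i%:R :> R by rewrite ler_nat.
  move: ia jb => /andP[ia _] /andP[_ jb]; move: ia jb.
  rewrite -[i]/(i.-1.+1) -!natr1 => ia jb ij.
  have : 0 <= (1 - la) * (1 - (b * n%:R - a * n%:R)) by apply: mulr_ge0; lra.
  lra.
have := H (Ordinal iN) (Ordinal jn) ij => /= {}H.
apply: le_trans (_ : count_in X (fun x : R => i%:R / n%:R < x <= j%:R / n%:R) <= _); last first.
  apply: le_count_in => x _ /andP[ix xj]; apply/andP; split.
    by apply: lt_trans ix; rewrite ltr_pdivlMr//; case/andP: ia.
  by apply: le_trans xj _; rewrite ler_pdivrMr//; case/andP: jb.
apply: le_trans H; move: ia jb => /andP[ia _] /andP[_ jb].
have : 0 <= (1 - la) * (j%:R - i%:R + 2 - (b * n%:R - a * n%:R)).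
  by apply: mulr_ge0; move: ia jb; rewrite -[i]/(i.-1.+1) -!natr1; lra.
lra.
Qed.

Lemma ln_ge_half (n : nat) : (2 <= n)%N -> 1 / 2 <= ln n%:R :> R.
Proof.
move=> n2; have n0 : 0 < n%:R :> R by rewrite ltr0n; lia.
rewrite -ler_expR lnK ?posrE//; apply: (@le_trans _ _ 2); last by rewrite ler_nat.
have := @expR_ge1Dx R (- (1 / 2)); rewrite expRN => h.
have e0 := @expR_gt0 R (1/2); rewrite -[leRHS]invrK -[leLHS]invrK lef_pV2 ?posrE; lra.
Qed.

(** The parameter of the Chernoff bound: the first value makes the greedy
    selection delete at most m points, the second one is for the range of m
    where the whole sample is kept. *)
Definition slack (n : nat) (m : R) : R :=
  if 6 * ln n%:R * n%:R / m + 3 <= m / 2 then m / (2 * n%:R) else 8 * ln n%:R / m.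

Lemma slack_gt0 n m : (2 <= n)%N -> 0 < m -> 0 < slack n m.
Proof.
move=> n2 m0; have := ln_ge_half n2 => ln0.
have n0 : 0 < n%:R :> R by rewrite ltr0n; lia.
by rewrite /slack; case: ifP => _; apply: divr_gt0 => //; lra.
Qed.

(** With u = n (ln n) / m, the greedy selection deletes at most
    m / 2 + 6 u + 3 points and leaves a deviation of at most 6 u + 3 points.
    If 6 u + 3 > m / 2, the deviation of X itself is at most
    8 u + 3 m / 8 + 2, which is again bounded by a multiple of u. *)
Lemma well_spread_subset_exists X (n : nat) (m : R) :
  (2 <= n)%N -> 0 < m -> m <= n%:R / 1000 ->
  {in X, forall x : R, 0 < x} -> {in X, forall x : R, x <= 1} ->
  ncard X = n%:R ->
  (forall i j : 'I_n.+1, (i <= j)%N ->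
    (1 - slack n m) * (j%:R - i%:R) - 3 * ln n%:R / slack n m
     <= count_in X (fun x : R => i%:R / n%:R < x <= j%:R / n%:R)) ->
  exists Y : {fset R}, [/\ (Y `<=` X)%fset, ncard X - m <= ncard Y &
    discrepancy Y <= 100 * (ln n%:R / m)].
Proof.
move=> n2 m0 mn X0 X1 Xn grid.
have la0 := slack_gt0 n2 m0; have l0 := ln_ge_half n2.
have n0 : 0 < n%:R :> R by rewrite ltr0n; lia.
have tau0 : 0 <= 3 * ln n%:R / slack n m by apply: divr_ge0; lra.
have spr := lower_spread_grid (ltnW n2) (ltW la0) tau0 grid.
set l : R := ln n%:R in l0 tau0 spr *.
pose u : R := l * n%:R / m.
(* As ln n >= 1 / 2 and n / m >= 1000; this absorbs the additive constants. *)
have u500 : 500 <= u by rewrite /u ler_pdivlMr//; nra.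
have uE : l / m = u / n%:R by rewrite /u; field; rewrite !gt_eqF.
have u6 : 6 * l * n%:R / m = 6 * u by rewrite /u !mulrA.
rewrite uE; move: la0 spr; rewrite /slack -/l u6.
case: ifPn => [mlarge|]; [move=> la0|rewrite -ltNge => msmall la0].
  have -> : (1 - m / (2 * n%:R)) * n%:R = n%:R - m / 2 by field; rewrite gt_eqF.
  have -> : 3 * l / (m / (2 * n%:R)) = 6 * u by rewrite /u; field; rewrite !gt_eqF.
  move=> /lower_spread_subset[|//|//|Y YX [Ylarge Yd]]; first lra.
  have Y0 : 0 < ncard Y by lra.
  exists Y; split => //; first by rewrite Xn; lra.
  apply: le_trans (Yd Y0) _; rewrite ler_pdivrMr// mulrA mulrAC ler_pdivlMr//.
  have : 0 <= u * (ncard Y - n%:R / 2) by apply: mulr_ge0; lra.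
  have : 0 <= u * n%:R by apply: mulr_ge0; lra.
  have : n%:R <= u * n%:R by rewrite ler_peMl; lra.
  lra.
have -> : 3 * l / (8 * l / m) = 3 / 8 * m by field; rewrite !gt_eqF//; lra.
move=> spr; exists X; split => //; first by rewrite Xn; lra.
rewrite mulrA -[n%:R in leRHS]Xn.
have lan : 8 * l / m * n%:R = 8 * u by rewrite /u; field; rewrite gt_eqF.
apply: discrepancy_le_div => [|t t01]; first by rewrite Xn.
apply: le_trans (lower_spread_two_sided (ltW la0) (ltW n0) X0 X1 Xn spr t01) _.
by rewrite lan; lra.
Qed.
End LowerSpread.

(** * Lower tails of the number of hits *)

Section FiniteBoole.
Context d (T : measurableType d) (R : realType) (P : probability T R).

Lemma finite_Boole (I : finType) (Q : pred I) (E : set T) (F : I -> set T) :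
  measurable E -> (forall i, measurable (F i)) ->
  (forall w, E w -> exists2 i, Q i & F i w) ->
  (P E <= \sum_(i | Q i) P (F i))%E.
Proof.
move=> mE mF EF.
have [mU PU] : measurable (\big[setU/set0]_(i | Q i) F i) /\
    (P (\big[setU/set0]_(i | Q i) F i) <= \sum_(i | Q i) P (F i))%E.
  apply: (big_ind2 (fun A e => measurable A /\ (P A <= e)%E)).
  - by rewrite measure0.
  - move=> A a B b [mA Aa] [mB Bb]; split; first exact: measurableU.
    by apply: le_trans (measureU2 _ mA mB) _; exact: leeD.
  - by move=> i _; split.
apply: le_trans PU; apply: le_measure; rewrite ?inE//.
by move=> w /EF[i Qi Fiw]; rewrite (bigD1 i)//=; left.
Qed.
End FiniteBoole.

Section LowerTail.
Context d (T : measurableType d) (R : realType) (P : probability T R).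
Context (n : nat) (x : 'I_n -> {RV P >-> R}).

Definition hits (A : set R) (w : T) : {set 'I_n} := [set i | `[< A (x i w) >]]%SET.

(** The indices in J hit A and all the others miss it.  These events partition
    the space, and independence gives their probabilities. *)
Definition cylinder (A : set R) (J : {set 'I_n}) : set T :=
  \bigcap_(i in [set` [set: 'I_n]%SET]) (x i @^-1` (if i \in J then A else ~` A)).

Lemma hits_cylinder A J : [set w | hits A w = J] = cylinder A J.
Proof.
apply/seteqP; split => w /=.
  move=> <- i _; rewrite inE /=; by case: asboolP.
move=> H; apply/setP => i; rewrite inE; have /= := H i.
rewrite inE => /(_ isT); case: ifP => _ /=; by case: asboolP.
Qed.

Lemma measurable_cylinder A J : measurable A -> measurable (cylinder A J).
Proof.
move=> mA; apply: fin_bigcap_measurable; first exact: finite_finset.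
move=> i _; rewrite -[X in measurable X]setTI; apply: measurable_funP => //.
by case: ifP => // _; exact: measurableC.
Qed.

Lemma measurable_hits A (Q : pred {set 'I_n}) : measurable A ->
  measurable [set w | Q (hits A w)].
Proof.
move=> mA; rewrite (_ : mkset _ = \bigcup_(J in [set J | Q J]) cylinder A J).
  by apply: fin_bigcup_measurable => // J _; exact: measurable_cylinder.
apply/seteqP; split => w /=.
  by move=> Qw; exists (hits A w) => //; rewrite -hits_cylinder.
by move=> [J /= QJ]; rewrite -hits_cylinder => /= ->.
Qed.

(** Chernoff's method without integrals.  The event is a union of cylinders
    with #|J| < s, and weighting each of them by expR (la * (s - #|J|)) >= 1
    can only increase the sum of their probabilities.  Extended to all J, the
    weighted sum is, by the distributive law, equal to
    expR (la * s) * (p * expR (- la) + 1 - p) ^+ n, and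
    expR (- la) <= 1 / (1 + la) <= 1 - la * (1 - la). *)
Lemma lower_tail (A : set R) (p la s : R) : mutually_independent x ->
  measurable A -> (forall i, P (x i @^-1` A) = p%:E) -> 0 <= la ->
  (P [set w | (#|hits A w|%:R < s)%R] <=
     (expR (la * s - n%:R * p * (la * (1 - la))))%:E)%E.
Proof.
move=> ind mA PA la0; pose Q (J : {set 'I_n}) := #|J|%:R < s.
have PA' i : P (x i @^-1` (~` A)) = (1 - p)%:E.
  rewrite preimage_setC probability_setC ?PA//.
  by rewrite -[X in measurable X]setTI; exact: measurable_funP.
have p01 : (0 < n)%N -> 0 <= p <= 1.
  move=> n0; have := PA (Ordinal n0) => Pp.
  rewrite -!lee_fin -Pp measure_ge0/= probability_le1//.
  by rewrite -[X in measurable X]setTI; exact: measurable_funP.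
have Pcyl J : P (cylinder A J) = (\prod_i (if i \in J then p else 1 - p))%:E.
  rewrite /cylinder ind; last by move=> i; case: ifP => // _; exact: measurableC.
  rewrite big_mkcond/= -prodEFin; apply: eq_bigr => i _; rewrite finset.in_setT.
  by case: ifP => _; [exact: PA|exact: PA'].
apply: (@le_trans _ _ (\sum_(J | Q J) P (cylinder A J))%E).
  apply: finite_Boole.
  - exact: (measurable_hits Q).
  - by move=> J; exact: measurable_cylinder.
  - by move=> w Qw; exists (hits A w) => //; rewrite -hits_cylinder.
rewrite (eq_bigr _ (fun J _ => Pcyl J)) sumEFin lee_fin.
have prod_ge0 (J : {set 'I_n}) (a b : R) :
    ((0 < n)%N -> 0 <= a /\ 0 <= b) -> 0 <= \prod_i (if i \in J then a else b).
  move=> ab; apply: prodr_ge0 => i _.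
  by have [|a0 b0] := ab; [exact: leq_ltn_trans (ltn_ord i)|case: ifP].
pose q := expR (- la).
apply: (@le_trans _ _ (\sum_(J : {set 'I_n})
    expR (la * s) * \prod_i (if i \in J then p * q else 1 - p))).
  rewrite big_mkcond/=; apply: ler_sum => J _; case: ifP => [QJ|_]; last first.
    apply: mulr_ge0; first exact: expR_ge0.
    apply: prod_ge0 => /p01/andP[p0 p1]; split; last by rewrite subr_ge0.
    by rewrite mulr_ge0 ?expR_ge0.
  have -> : \prod_i (if i \in J then p * q else 1 - p) =
      q ^+ #|J| * \prod_i (if i \in J then p else 1 - p).
    have -> : q ^+ #|J| = \prod_i (if i \in J then q else 1).
      by rewrite -big_mkcond prodr_const.
    rewrite -big_split/=.
    by apply: eq_bigr => i _; case: ifP => _; rewrite ?mul1r// mulrC.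
  rewrite mulrA ler_peMl//.
    by apply: prod_ge0 => /p01/andP[p0 p1]; rewrite subr_ge0.
  rewrite /q -expRM_natl -expRD; apply: le_trans (expR_ge1Dx _).
  have : 0 <= la * (s - #|J|%:R) by rewrite mulr_ge0// subr_ge0 ltW.
  lra.
rewrite -mulr_sumr -(bigA_distr _ _ (fun=> p * q) (fun=> 1 - p)) prodr_const card_ord.
case: (posnP n) => [->|n0]; first by rewrite expr0 mulr1 !mul0r subr0.
have /andP[p0 p1] := p01 n0.
rewrite expRD ler_wpM2l ?expR_ge0//.
rewrite (_ : - (n%:R * _ * _) = n%:R * - (p * (la * (1 - la)))); last by ring.
rewrite expRM_natl lerXn2r ?nnegrE ?expR_ge0//.
  by rewrite addr_ge0 ?subr_ge0// mulr_ge0// expR_ge0.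
apply: le_trans (expR_ge1Dx _).
have : q <= 1 - la * (1 - la).
  have q1 : q * (1 + la) <= 1.
    rewrite /q expRN mulrC ler_pdivrMr ?expR_gt0// mul1r; exact: expR_ge1Dx.
  have : 0 <= la ^+ 3 by rewrite exprn_ge0.
  have : 0 < 1 + la by lra.
  move=> la1 la3; rewrite -(ler_pM2r la1); apply: le_trans q1 _; lra.
rewrite /= => /(ler_wpM2l p0); lra.
Qed.
End LowerTail.

(** * Measurability of the event *)

Section DiscrepancyRat.
Context {R : realType}.
Implicit Type Y : {fset R}.

Lemma gap_le1 Y (t : R) : 0 <= t <= 1 -> gap Y t <= 1.
Proof.
move=> /andP[t0 t1]; have c0 : 0 <= count_in Y (fun y : R => 0 <= y <= t) / ncard Y.
  by apply: divr_ge0; exact: ler0n.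
have c1 : count_in Y (fun y : R => 0 <= y <= t) / ncard Y <= 1.
  have [->|Y0] := eqVneq (ncard Y) 0; first by rewrite invr0 mulr0.
  rewrite ler_pdivrMr ?lt_def ?Y0 ?ler0n// mul1r ncardE.
  exact: le_count_in.
by rewrite /gap ler_norml; lra.
Qed.

Lemma gap_le_discrepancy Y (t : R) : 0 <= t <= 1 -> gap Y t <= discrepancy Y.
Proof.
move=> t01; apply: ub_le_sup; last by exists t => //=; rewrite in_itv.
by exists 1 => _ [s /= + <-]; rewrite in_itv/=; exact: gap_le1.
Qed.

(** The counting function of Y is constant on [t, t + e[: it is right
    continuous. *)
Lemma next_point Y (t : R) : exists2 e : R, 0 < e &
  {in Y, forall y : R, t < y -> t + e <= y}.
Proof.
suff H (s : seq R) : exists2 e : R, 0 < e & {in s, forall y : R, t < y -> t + e <= y}.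
  exact: H Y.
elim: s => [|a s [e e0 IH]]; first by exists 1.
have [at_|ta] := leP a t.
  exists e => // y; rewrite inE => /predU1P[->|/IH//]; by rewrite ltNge at_.
exists (Num.min e (a - t)); first by rewrite lt_min e0 subr_gt0.
move=> y; rewrite inE => /predU1P[->|ys] ty; rewrite -lerBrDl ge_min.
  by rewrite lexx orbT.
by rewrite lerBrDl IH.
Qed.

(** If the deviation exceeds b at t < 1, right continuity of the counting
    function makes it exceed b at rational points slightly to the right of t;
    the point t = 1 is itself rational. *)
Lemma discrepancy_le_rat Y (b : R) :
  (forall q : rat, 0 <= (ratr q : R) <= 1 -> gap Y (ratr q) <= b) ->
  discrepancy Y <= b.
Proof.
move=> H; apply: discrepancy_le => t /andP[t0 t1].
have [t1'|] := ltP t 1; last first.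
  move=> t1'; have -> : t = ratr 1 by rewrite rmorph1; lra.
  by apply: H; rewrite rmorph1 ler01 lexx.
have [e e0 He] := next_point Y t.
rewrite leNgt /gap; apply/negP => big; set g := `|_| in big.
pose u := Num.min (Num.min (t + e) 1) (t + (g - b)).
have tu : t < u by rewrite !lt_min; apply/andP; split; [apply/andP; split|]; lra.
have [q] := rat_in_itvoo tu; rewrite in_itv/= !lt_min => /andP[tq /andP[/andP[qe q1] qg]].
have := H q; rewrite (le_trans t0 (ltW tq)) (ltW q1) => /(_ isT).
rewrite /gap (@eq_count_in _ _ _ (fun y : R => 0 <= y <= t)); last first.
  move=> y yY /=; case: (0 <= y) => //=; have [yt|ty] := leP y t.
    by rewrite (le_trans yt (ltW tq)).
  by apply/negbTE; rewrite -ltNge (lt_le_trans qe)// He.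
set c := _ / _ => cq; suff : g <= b + (ratr q - t) by lra.
rewrite /g -[X in `|X|](subrKA (ratr q)) -/c.
apply: le_trans (ler_normD _ _) _.
by rewrite lerD// gtr0_norm// subr_gt0.
Qed.

End DiscrepancyRat.

Section Measurability.
Context d (T : measurableType d) (R : realType) (P : probability T R).
Context (n : nat) (x : 'I_n -> {RV P >-> R}).

Definition subsample (J : {set 'I_n}) (w : T) : {fset R} :=
  [fset x i w | i in J]%fset.

(** Coinciding points are counted once in a sample, so each value is attributed
    to the smallest index in J that takes it. *)
Definition first_in (J : {set 'I_n}) (i : 'I_n) (w : T) : bool :=
  (i \in J) && [forall j in J, (j < i)%N ==> (x j w != x i w)].

Lemma count_in_subsample (J : {set 'I_n}) (p : pred R) w :
  count_in (subsample J w) p = \sum_(i | first_in J i w) (p (x i w))%:R.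
Proof.
pose J' := [set i | first_in J i w]%SET.
have inj : {in J' &, injective (fun i => x i w)}.
  move=> i j; rewrite !inE => /andP[iJ /forall_inP ci] /andP[jJ /forall_inP cj] xij.
  apply/val_inj/eqP; rewrite eqn_leq /= leqNgt [X in _ && X]leqNgt.
  apply/andP; split; apply/negP => lt.
    by have := ci j jJ; rewrite lt/= xij eqxx.
  by have := cj i iJ; rewrite lt/= xij eqxx.
have -> : subsample J w = [fset x i w | i in J']%fset.
  apply/fsetP => y; apply/imfsetP/imfsetP => -[i /= iJ ->]; last first.
    by exists i => //; move: iJ; rewrite inE => /andP[].
  have : exists k, [exists i' : 'I_n, [&& i' \in J, val i' == k & x i' w == x i w]].
    by exists (val i); apply/existsP; exists i; rewrite iJ !eqxx.
  move=> /ex_minnP[k /existsP[i' /and3P[i'J /eqP i'k /eqP xi']] kmin].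
  exists i' => //; rewrite inE /first_in i'J/=; apply/forall_inP => j jJ.
  apply/implyP => ji; apply/negP => /eqP xji.
  have := kmin (val j); rewrite leqNgt -i'k ji => /(_ _)/negP; apply => //.
  by apply/existsP; exists j; rewrite jJ eqxx xji xi' eqxx.
rewrite count_inE big_imfset//= big_enum_cond/=.
by apply: eq_bigl => i; rewrite inE andbT.
Qed.

Lemma measurable_first_in J i : measurable [set w | first_in J i w].
Proof.
rewrite /first_in; case: (i \in J) => /=; last by rewrite set_false.
rewrite (_ : mkset _ = \bigcap_(j in [set j | (j \in J) && (j < i)%N])
    ~` [set w | x j w == x i w]).
  apply: fin_bigcap_measurable; first exact: finite_finset.
  move=> j _; apply: measurableC.
  have := @measurable_fun_eqr _ _ _ setT (x j) (x i)
    (measurable_funP _) (measurable_funP _).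
  by move=> /(_ measurableT [set true] I); rewrite setTI.
apply/seteqP; split => w /=.
  by move=> /forall_inP H j /= /andP[/H/implyP jJ /jJ /negP].
move=> H; apply/forall_inP => j jJ; apply/implyP => ji; apply/negP.
by apply: H => /=; rewrite jJ.
Qed.

Lemma measurable_count_in J (p : pred R) : measurable [set y | p y] ->
  measurable_fun setT (fun w => count_in (subsample J w) p).
Proof.
move=> mp; under eq_fun do rewrite count_in_subsample big_mkcond/=.
apply: measurable_sum => i.
rewrite (_ : (fun _ => _) = \1_([set w | first_in J i w] `&` x i @^-1` [set y | p y])).
  apply: measurable_indic; apply: measurableI; first exact: measurable_first_in.
  exact: measurable_funPTI.
apply/funext => w; rewrite indicE in_setI.
have memE (Q : pred T) : (w \in [set w' | Q w']) = Q w.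
  by apply/idP/idP; rewrite inE.
rewrite (memE (first_in J i)) (memE (fun w' => p (x i w'))).
by case: first_in; case: (p _).
Qed.

(** Integer-valued functions only have countably many joint values, so Q is
    arbitrary; the quotient in the deviation needs no separate treatment. *)
Lemma measurable_nat_rel (f g : T -> R) (Q : R -> R -> Prop) :
  measurable_fun setT f -> measurable_fun setT g ->
  (forall w, exists k : nat, f w = k%:R) -> (forall w, exists k : nat, g w = k%:R) ->
  measurable [set w | Q (f w) (g w)].
Proof.
move=> mf mg fN gN.
have lev (h : T -> R) (k : nat) : measurable_fun setT h -> measurable (h @^-1` [set k%:R]).
  by move=> mh; rewrite -[X in measurable X]setTI; exact: mh.
rewrite (_ : mkset _ = \bigcup_k \bigcup_(l in [set l | Q k%:R l%:R])
    (f @^-1` [set k%:R] `&` g @^-1` [set l%:R])).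
  apply: bigcupT_measurable => k; apply: bigcup_measurable => l _.
  by apply: measurableI; exact: lev.
apply/seteqP; split => w /=.
  have [k fk] := fN w; have [l gl] := gN w.
  by rewrite fk gl => Qkl; exists k => //; exists l.
by move=> [k _ [l /= Qkl [-> ->]]].
Qed.

Lemma subsample_setT w : subsample [set: 'I_n]%SET w = sample x w.
Proof.
by apply/fsetP => y; apply/imfsetP/imfsetP => -[i /= _ ->]; exists i; rewrite ?inE.
Qed.

Lemma measurable_discrepancy J (b : R) :
  measurable [set w | discrepancy (subsample J w) <= b].
Proof.
rewrite (_ : mkset _ = ~` \bigcup_(q : rat)
    [set w | ~ (0 <= (ratr q : R) <= 1 -> gap (subsample J w) (ratr q) <= b)]).
  apply/measurableC/bigcupT_measurable_rat => q.
  pose Q (u v : R) := ~ (0 <= (ratr q : R) <= 1 -> `|u / v - ratr q| <= b).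
  rewrite /gap; under eq_set do rewrite ncardE.
  apply: (@measurable_nat_rel _ _ Q).
  - apply: measurable_count_in; rewrite [X in measurable X](_ : _ = `[0, ratr q]%classic).
      exact: measurable_itv.
    by apply/seteqP; split => y /=; rewrite in_itv.
  - by apply: measurable_count_in; rewrite set_true.
  - by move=> w; eexists; reflexivity.
  - by move=> w; eexists; reflexivity.
rewrite setC_bigcup; apply/seteqP; split => w /=.
  move=> H q _ /=; apply => q01.
  exact: le_trans (gap_le_discrepancy _ q01) H.
move=> H; apply: discrepancy_le_rat => q q01.
by have /contrapT := H q I; apply.
Qed.

Lemma measurable_good_subset_event (m : R) (b : \bar R) :
  measurable (good_subset_event x m b).
Proof.
rewrite (_ : good_subset_event x m b = \bigcup_(J : {set 'I_n})
   ([set w | ncard (sample x w) - m <= ncard (subsample J w)] `&`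
    [set w | ((discrepancy (subsample J w))%:E <= b)%E])).
  apply: fin_bigcup_measurable => [|J _]; first exact: finite_finset.
  apply: measurableI.
    under eq_set do rewrite -subsample_setT !ncardE.
    apply: (@measurable_nat_rel _ _ (fun u v => u - m <= v)).
    - by apply: measurable_count_in; rewrite set_true.
    - by apply: measurable_count_in; rewrite set_true.
    - by move=> w; eexists; reflexivity.
    - by move=> w; eexists; reflexivity.
  case: b => [b| |].
  - by under eq_set do rewrite lee_fin; exact: measurable_discrepancy.
  - by under eq_set do rewrite leey; rewrite set_true.
  - by under eq_set do rewrite leeNy_eq/=; rewrite set_false.
apply/seteqP; split => w /=.
  move=> [Y [YX Yc Yd]]; pose J := [set i | x i w \in Y]%SET.
  suff YJ : Y = subsample J w by exists J => //=; rewrite -YJ.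
  apply/fsetP => y; apply/idP/imfsetP => [yY|[i /=]]; last by rewrite inE => ? ->.
  have /imfsetP[i _ yi] := fsubsetP YX y yY.
  by exists i => //=; rewrite inE -yi.
move=> [J _ [/= c dd]]; exists (subsample J w); split => //.
by apply/fsubsetP => y /imfsetP[i _ ->]; apply/imfsetP; exists i.
Qed.

End Measurability.

(** * Almost sure properties of a uniform sample *)

Lemma uniform_prob01_itv (R : realType) (a b : R) : 0 <= a -> a <= b -> b <= 1 ->
  uniform_prob (@ltr01 R) `]a, b] = (b - a)%:E.
Proof.
move=> a0 ab b1; rewrite /uniform_prob.
rewrite (eq_integral (fun=> 1%E)); last first.
  move=> x; rewrite inE/= in_itv/= => /andP[ax xb].
  by rewrite /uniform_pdf (ltW (le_lt_trans a0 ax)) (le_trans xb b1) subr0 invr1.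
rewrite integral_cst//= mul1e lebesgue_measure_itv/= lte_fin.
case: ltP => [_|ba]; first by rewrite EFinB.
by rewrite (@le_anti _ _ a b) ?ab// subrr.
Qed.

Section IidUniform.
Context d (T : measurableType d) (R : realType) (P : probability T R).
Context (n : nat) (x : 'I_n -> {RV P >-> R}).
Hypothesis iid_x : iid_uniform01 x.

Lemma prob_itv i (a b : R) : 0 <= a -> a <= b -> b <= 1 ->
  P (x i @^-1` `]a, b]) = (b - a)%:E.
Proof.
by move=> a0 ab b1; rewrite -uniform_prob01_itv// -(iid_x.2 i).
Qed.

Definition outside i : set T := x i @^-1` (~` `]0, 1]).

Lemma prob_outside i : P (outside i) = 0.
Proof.
have -> : outside i = ~` (x i @^-1` `]0, 1]) by [].
rewrite probability_setC; last by apply: measurable_funPTI; exact: measurable_itv.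
by rewrite prob_itv// subr0 subee.
Qed.

(** The coincidence is restricted to ]0, 1] so that finitely many cells cover
    it. *)
Definition clash i j : set T :=
  x i @^-1` `]0, 1] `&` [set w | x i w == x j w].

Lemma measurable_clash i j : measurable (clash i j).
Proof.
apply: measurableI; first by apply: measurable_funPTI; exact: measurable_itv.
have := @measurable_fun_eqr _ _ _ setT (x i) (x j)
  (measurable_funP _) (measurable_funP _).
by move=> /(_ measurableT [set true] I); rewrite setTI.
Qed.

(** Cut ]0, 1] into M cells: two coinciding points lie in the same cell, which
    has probability M / M ^ 2, and M is arbitrary. *)
Lemma prob_clash i j : i != j -> P (clash i j) = 0.
Proof.
move=> ij.
have small (M : nat) : (0 < M)%N -> (P (clash i j) <= (M%:R^-1)%:E)%E.
  move=> M0; have M0R : 0 < M%:R :> R by rewrite ltr0n.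
  pose I (k : nat) : set R := `]k%:R / M%:R, k.+1%:R / M%:R]%classic.
  pose F (k : 'I_M) := \bigcap_(l in [set` [set i; j]%SET]) x l @^-1` I k.
  have PF k : P (F k) = (M%:R^-1 * M%:R^-1)%:E.
    rewrite /F iid_x.1; last by move=> _; exact: measurable_itv.
    have PI l : P (x l @^-1` I k) = (M%:R^-1)%:E.
      rewrite prob_itv ?divr_ge0//.
      - by rewrite -mulrBl -natr1 addrAC subrr add0r mul1r.
      - by rewrite ler_pM2r ?invr_gt0// ler_nat.
      - by rewrite ler_pdivrMr// mul1r ler_nat.
    by rewrite finset.big_setU1 ?inE//= finset.big_set1 !PI EFinM.
  apply: (@le_trans _ _ (\sum_(k < M) P (F k))%E).
    apply: finite_Boole.
    - exact: measurable_clash.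
    - move=> k; apply: fin_bigcap_measurable; first exact: finite_finset.
      by move=> l _; by apply: measurable_funPTI; exact: measurable_itv.
    - move=> w [/=]; rewrite in_itv/= => /andP[xi0 xi1] /eqP xij.
      have xM : 0 < x i w * M%:R by rewrite mulr_gt0.
      pose c := Num.ceil (x i w * M%:R).
      have c0 : 0 < c by rewrite /c ceil_gt0.
      have cM : c <= M%:Z by rewrite /c ceil_le_int -pmulrn ger_pMl.
      have kM : (`|c|.-1 < M)%N by lia.
      have cE : c = `|c|.-1.+1%:Z by lia.
      exists (Ordinal kM) => // l H.
      suff Ixi : I (Ordinal kM) (x i w).
        by move: H; rewrite /= !inE => /orP[] /eqP -> //; rewrite -xij.
      have cR : c%:~R = `|c|.-1.+1%:R :> R by rewrite {1}cE -pmulrn.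
      have := ceil_itv (x i w * M%:R); rewrite -/c intrD rmorphN1 cR.
      rewrite /I /= in_itv/= ltr_pdivrMr// ler_pdivlMr// => /andP[+ ->].
      by rewrite -natr1 addrK => ->.
  rewrite (eq_bigr _ (fun k _ => PF k)) sumEFin sumr_const card_ord.
  by rewrite -[(_ * _) *+ _]mulr_natl mulrA mulfV ?mul1r// gt_eqF.
apply/eqP; rewrite eq_le measure_ge0 andbT.
apply/lee_addgt0Pr => e e0; rewrite add0e.
have := small (Num.truncn e^-1).+1 isT => /le_trans; apply.
rewrite lee_fin -[leRHS]invrK lef_pV2 ?posrE ?invr_gt0// ltW//.
exact: truncnS_gt.
Qed.

Lemma ae_distinct : exists N : set T, [/\ measurable N, P N = 0 &
  forall w, ~ N w -> injective (fun i => x i w) /\ forall i, 0 < x i w <= 1].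
Proof.
pose Out := \bigcup_(i : 'I_n) outside i.
pose Cl := \bigcup_(ij in [set ij : 'I_n * 'I_n | ij.1 != ij.2]) clash ij.1 ij.2.
have mout i : measurable (outside i).
  by apply: measurable_funPTI; apply: measurableC; exact: measurable_itv.
have mO : measurable Out.
  by apply: fin_bigcup_measurable => [|i _]; [exact: finite_finset|exact: mout].
have mC : measurable Cl.
  by apply: fin_bigcup_measurable => [|i _]; [exact: finite_finset|exact: measurable_clash].
have PO : (P Out <= \sum_(i < n) P (outside i))%E.
  by apply: finite_Boole => // w [i _ xi]; exists i.
have PC : (P Cl <= \sum_(ij : 'I_n * 'I_n | ij.1 != ij.2) P (clash ij.1 ij.2))%E.
  by apply: finite_Boole => // ij; exact: measurable_clash.
rewrite big1 in PO; last by move=> i _; exact: prob_outside.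
rewrite big1 in PC; last by move=> ij; exact: prob_clash.
exists (Out `|` Cl); split; first exact: measurableU.
  apply/eqP; rewrite eq_le measure_ge0 andbT.
  by apply: le_trans (measureU2 _ mO mC) _; rewrite -(adde0 0%E) leeD.
move=> w NN; have in01 i : 0 < x i w <= 1.
  apply: contrapT => xi; apply: NN; left; exists i => //=.
split => // i j xij; apply: contrapT => /eqP ij; apply: NN; right.
by exists (i, j) => //; split => /=; rewrite ?in_itv/= ?in01// xij.
Qed.

Lemma count_in_sample (A : set R) (p : pred R) w : injective (fun i => x i w) ->
  (forall y, p y <-> A y) -> count_in (sample x w) p = #|hits x A w|%:R.
Proof.
move=> inj pA; rewrite count_inE big_imfset/=; last by move=> i j _ _; exact: inj.
rewrite big_enum/= -sumr_const [RHS]big_mkcond/=; apply: eq_bigr => i _.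
rewrite inE -[p (x i w)](asboolb) (asbool_equiv_eq (pA _)).
by case: (`[< _ >]).
Qed.

Lemma ncard_sample w : injective (fun i => x i w) -> ncard (sample x w) = n%:R.
Proof.
move=> inj; rewrite ncardE (@count_in_sample setT)//.
rewrite (_ : hits x setT w = [set: 'I_n]%SET) ?cardsT ?card_ord//.
by apply/setP => i; rewrite !inE asboolT.
Qed.

End IidUniform.

(** * Probability of finding a well-spread subset *)

Section GoodSubset.
Context d (T : measurableType d) (R : realType) (P : probability T R).
Context (n : nat) (x : 'I_n -> {RV P >-> R}).
Hypothesis iid_x : iid_uniform01 x.

(** The grid interval from i / n to j / n falls short of the lower bound
    that the greedy selection needs. *)
Definition sparse (la : R) (i j : nat) : set T :=
  [set w | #|hits x `]i%:R / n%:R, j%:R / n%:R] w|%:R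
     < (1 - la) * (j%:R - i%:R) - 3 * ln n%:R / la].

Lemma measurable_sparse la i j : measurable (sparse la i j).
Proof.
apply: (@measurable_hits _ _ _ _ _ _ _ (fun J : {set 'I_n} => #|J|%:R < _)).
exact: measurable_itv.
Qed.

(** The term 3 (ln n) / la makes the exponent in the Chernoff bound exactly
    - 3 ln n. *)
Lemma prob_sparse la (i j : nat) : (0 < n)%N -> 0 < la -> (i <= j <= n)%N ->
  (P (sparse la i j) <= (n%:R^-1 ^+ 3)%:E)%E.
Proof.
move=> n0 la0 /andP[ij jn]; have n0R : 0 < n%:R :> R by rewrite ltr0n.
pose p : R := j%:R / n%:R - i%:R / n%:R.
have Pp k : P (x k @^-1` `]i%:R / n%:R, j%:R / n%:R]) = p%:E.
  rewrite prob_itv ?divr_ge0//.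
  - by rewrite ler_pM2r ?invr_gt0// ler_nat.
  - by rewrite ler_pdivrMr// mul1r ler_nat.
apply: le_trans (lower_tail _ iid_x.1 (measurable_itv _) Pp (ltW la0)) _.
rewrite lee_fin (_ : la * _ - _ = 3%:R * - ln n%:R); last first.
  by rewrite /p; field; rewrite !gt_eqF.
by rewrite expRM_natl expRN lnK.
Qed.

(** Outside a null set, a failure forces some grid interval to be sparse;
    there are at most (n + 1) ^ 2 <= 4 n ^ 2 of them, each with
    probability at most n ^ -3. *)
Lemma good_subset_event_prob (m : R) : (2 <= n)%N -> 0 < m -> m <= n%:R / 1000 ->
  ((1 - 4 * n%:R^-1)%:E <=
    P (good_subset_event x m (100 * (ln n%:R / m))%:E))%E.
Proof.
move=> n2 m0 mn; have n0 : (0 < n)%N := ltnW n2.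
have n0R : 0 < n%:R :> R by rewrite ltr0n.
set G := good_subset_event _ _ _.
have mG : measurable G by exact: measurable_good_subset_event.
pose la := slack n m; have la0 : 0 < la := slack_gt0 n2 m0.
have [N [mN PN NP]] := ae_distinct iid_x.
pose I2 := ('I_n.+1 * 'I_n.+1)%type.
have PB : (P (~` G `\` N) <=
    \sum_(ij : I2 | (ij.1 <= ij.2)%N) P (sparse la ij.1 ij.2))%E.
  apply: finite_Boole.
  - by apply: measurableD => //; exact: measurableC.
  - by move=> ij; exact: measurable_sparse.
  move=> w [nG /NP[inj x01]]; apply: contrapT => nsp; apply: nG.
  have X01 : {in sample x w, forall y : R, 0 < y <= 1}.
    by move=> y /imfsetP[i _ ->].
  have [||||Y [YX Yc Yd]] := @well_spread_subset_exists R (sample x w) n m n2 m0 mn.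
  - by move=> y /X01/andP[].
  - by move=> y /X01/andP[].
  - exact: ncard_sample.
  - move=> i j ij; rewrite (@count_in_sample _ _ _ _ _ x `]i%:R / n%:R, j%:R / n%:R])//.
    by rewrite leNgt; apply/negP => ijs; apply: nsp; exists (i, j).
  - by exists Y; split => //; rewrite lee_fin.
have PnG : (P (~` G) <= (4 * n%:R^-1)%:E)%E.
  apply: (@le_trans _ _ (P (N `|` (~` G `\` N)))).
    apply: le_measure; rewrite ?inE.
    - exact: measurableC.
    - by apply: measurableU => //; apply: measurableD => //; exact: measurableC.
    - by move=> w nG; have [|] := pselect (N w); [left|right].
  apply: le_trans (measureU2 _ mN _) _.
    by apply: measurableD => //; exact: measurableC.
  rewrite [X in (X + _)%E]PN add0e; apply: le_trans PB _.
  apply: (@le_trans _ _ (\sum_(ij : I2) (n%:R^-1 ^+ 3)%:E)%E).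
    rewrite big_mkcond; apply: lee_sum => -[i j] _ /=; case: ifP => [ij|_].
      by apply: prob_sparse => //; rewrite ij -ltnS ltn_ord.
    by rewrite lee_fin exprn_ge0 ?invr_ge0.
  rewrite sumEFin lee_fin sumr_const card_prod card_ord -[_ *+ _]mulr_natr.
  rewrite exprVn mulrC ler_pdivrMr ?exprn_gt0//.
  have -> : 4 * n%:R^-1 * n%:R ^+ 3 = 4 * n%:R ^+ 2 :> R by field; rewrite gt_eqF.
  by rewrite -natrX -natrM ler_nat; nia.
have := probability_setC P mG => PC; rewrite PC in PnG.
move: PnG; rewrite -(fineK (fin_num_measure P _ mG)) -EFinB !lee_fin; lra.
Qed.

Lemma good_subset_event_top (m : R) : 0 <= m ->
  good_subset_event x m +oo = setT.
Proof.
move=> m0; apply/seteqP; split => // w _; exists (sample x w); split => //.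
- by rewrite lerBlDr lerDl.
- exact: leey.
Qed.

(** For n = 1 the required probability 1 - 4 is negative, and for m = 0 the
    event is the whole space. *)
Lemma holds_good_subset_event (m : R) : (1 <= n)%N -> 0 <= m -> m <= n%:R / 1000 ->
  holds_with_prob_ge P (1 - 4 * n%:R `^ (- 1))
    (good_subset_event x m (discrepancy_bound n m)).
Proof.
move=> n1 m0 mn; split; first exact: measurable_good_subset_event.
have n0R : 0 < n%:R :> R by rewrite ltr0n.
rewrite (powR_inv1 (ltW n0R)) /discrepancy_bound; have [->|mn0] := eqVneq m 0.
  have K1 : 1 - 4 * n%:R^-1 <= 1 :> R by rewrite gerBl mulr_ge0// invr_ge0 ltW.
  rewrite -lee_fin in K1; rewrite good_subset_event_top// probability_setT.
  exact: K1.
have [n2|n2] := leqP 2 n; first by apply: good_subset_event_prob => //; rewrite lt_def mn0.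
apply: le_trans (measure_ge0 _ _).
have -> : n = 1%N by lia.
by rewrite lee_fin invr1; lra.
Qed.

(** Almost surely 0.999 n <= #|Y| <= n, hence n <= #|Y| ^ 2 for n >= 2 and
    ln n <= 2 ln #|Y|, so that ln #|Y| / #|Y| and ln n / n are within a factor
    2 of each other. *)
Lemma ae_log_ratio (c : R) : 0 < c -> c <= 1 / 1000 -> (2 <= n)%N ->
  \forall w \ae P, forall Y : {fset R}, (Y `<=` sample x w)%fset ->
    ncard (sample x w) - c * n%:R <= ncard Y ->
    50 / c * (ln (ncard Y) / ncard Y) <= 100 / c * (ln n%:R / n%:R) /\
    100 / c * (ln n%:R / n%:R) <= 200 / c * (ln (ncard Y) / ncard Y).
Proof.
move=> c0 c1 n2; have [N [mN PN NP]] := ae_distinct iid_x.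
exists N; split => // w /= nY; apply: contrapT => /NP[inj _]; apply: nY => Y YX.
rewrite ncard_sample// => cY.
have Yn : ncard Y <= n%:R.
  by rewrite -(ncard_sample inj) ler_nat; exact: fsubset_leq_card.
have n2R : 2 <= n%:R :> R by rewrite ler_nat.
have cn : c * n%:R <= n%:R / 1000 by rewrite mulrC ler_wpM2l//; lra.
set y := ncard Y in cY Yn *; have y1 : 1 < y by lra.
set nn : R := n%:R in Yn n2R cn cY *.
have lny : ln y <= ln nn by rewrite ler_ln ?posrE//; lra.
have lnn : ln nn <= 2 * ln y.
  rewrite -mulrC mulr_natr -lnXn; last lra.
  rewrite ler_ln ?posrE ?exprn_gt0//; [nra|lra|lra].
have lny0 : 0 < ln y by rewrite ln_gt0.
have hi : ln y / y <= 2 * (ln nn / nn).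
  rewrite mulrA ler_pdivrMr; last lra.
  rewrite mulrAC ler_pdivlMr; last lra.
  have : 0 <= (ln nn - ln y) * nn by apply: mulr_ge0; lra.
  have : 0 <= ln nn * (2 * y - nn) by apply: mulr_ge0; lra.
  lra.
have lo : ln nn / nn <= 2 * (ln y / y).
  rewrite mulrA ler_pdivrMr; last lra.
  rewrite mulrAC ler_pdivlMr; last lra.
  have : 0 <= (2 * ln y - ln nn) * y by apply: mulr_ge0; lra.
  have : 0 <= ln y * (nn - y) by apply: mulr_ge0; lra.
  lra.
have ci : 0 < c^-1 by rewrite invr_gt0.
split.
- rewrite [100 / c](_ : _ = 50 / c * 2); last by field; rewrite gt_eqF.
  by rewrite -[leRHS]mulrA ler_wpM2l// divr_ge0// ltW.
- rewrite [200 / c](_ : _ = 100 / c * 2); last by field; rewrite gt_eqF.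
  by rewrite -[leRHS]mulrA ler_wpM2l// divr_ge0// ltW.
Qed.

End GoodSubset.

Unset Implicit Arguments.

Theorem mainTheorem1 (R : realType) :
  exists C K : R, [/\ 0 < C, 0 < K,
    (forall (n : nat) (m : R), (1 <= n)%N -> 0 <= m -> m <= n%:R / 1000 ->
      forall (d : measure_display) (T : measurableType d)
        (P : probability T R) (x : 'I_n -> {RV P >-> R}),
      iid_uniform01 x ->
      holds_with_prob_ge P (1 - K * n%:R `^ (- C))
        (good_subset_event x m (discrepancy_bound n m))) &
    (forall c : R, 0 < c -> c <= 1 / 1000 ->
      exists a b : R, [/\ 0 < a, 0 < b &
        forall n : nat, (1 <= n)%N ->
        forall (d : measure_display) (T : measurableType d)
          (P : probability T R) (x : 'I_n -> {RV P >-> R}),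
        iid_uniform01 x ->
        holds_with_prob_ge P (1 - K * n%:R `^ (- C))
          (good_subset_event x (c * n%:R)
            (100 / c * (ln n%:R / n%:R))%:E) /\
        ((2 <= n)%N ->
          \forall w \ae P, forall Y : {fset R},
            (Y `<=` sample x w)%fset ->
            ncard (sample x w) - c * n%:R <= ncard Y ->
            a * (ln (ncard Y) / ncard Y) <= 100 / c * (ln n%:R / n%:R) /\
            100 / c * (ln n%:R / n%:R) <= b * (ln (ncard Y) / ncard Y))])].
Proof.
exists 1, 4; split => //.
  by move=> n m n1 m0 mn d T P x iid_x; exact: holds_good_subset_event.
move=> c c0 c1; exists (50 / c), (200 / c); split; [exact: divr_gt0|exact: divr_gt0|].
move=> n n1 d T P x iid_x; split; last by move=> n2; exact: ae_log_ratio.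
have n0 : 0 < n%:R :> R by rewrite ltr0n.
have := @holds_good_subset_event _ _ _ _ _ _ iid_x (c * n%:R) n1.
rewrite /discrepancy_bound mulf_eq0 !gt_eqF//=.
have -> : 100 * (ln n%:R / (c * n%:R)) = 100 / c * (ln n%:R / n%:R).
  by field; rewrite !gt_eqF.
by apply; [rewrite mulr_ge0 ?ltW|rewrite mulrC ler_wpM2l//; lra].
Qed.
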